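(* The Urysohn sphere $\mathbf{S}$ is $1/3$-indivisible.
   Context: A metric space is ultrahomogeneous when every isometry between two of its finite subspaces extends to an isometry of the space onto itself. The Urysohn sphere $\mathbf{S}$ is, up to isometry, the unique complete separable ultrahomogeneous metric space of diameter $1$ into which every separable metric space of diameter at most $1$ embeds isometrically. For a metric space $\mathbf{X}=(X,d^{\mathbf{X}})$, $Y\subset X$ and $\varepsilon\geqslant 0$, let $(Y)_\varepsilon=\{x\in X:\exists y\in Y\ d^{\mathbf{X}}(x,y)\leqslant\varepsilon\}$. The space $\mathbf{X}$ is $\varepsilon$-indivisible when for every integer $k\geqslant 1$ and every map $\chi:\mathbf{X}\to k=\{0,\dots,k-1\}$, there are $i<k$ and a subspace $\widetilde{\mathbf{X}}\subset\mathbf{X}$ isometric to $\mathbf{X}$ such that $\widetilde{\mathbf{X}}\subset(\chi^{-1}(\{i\}))_\varepsilon$. *)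

(* Defs.v *)
From HB Require Import structures.
From mathcomp Require Import all_boot all_order all_algebra.
From mathcomp Require Import all_classical all_reals all_analysis.

Set Implicit Arguments.
Unset Strict Implicit.
Unset Printing Implicit Defensive.

Import Order.TTheory GRing.Theory Num.Theory.
Import numFieldNormedType.Exports.

Local Open Scope classical_set_scope.
Local Open Scope ring_scope.

(* The map f is total on X, but only its values on the
   subspace A are constrained; f restricted to A is an isometry of A onto B. *)
Definition isometry_onto {R : realType} {X Y : metricType R}
    (A : set X) (B : set Y) (f : X -> Y) : Prop :=
  set_bij A B f /\
  forall x y : X, A x -> A y -> mdist (f x) (f y) = mdist x y.

(* As f is total, this is meant for X inhabited only if Y is; below, either
   X = Y or A is the whole space X, so that every isometry of A onto B is the
   restriction of such an f. *)
Definition isometric {R : realType} {X Y : metricType R}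
    (A : set X) (B : set Y) : Prop :=
  exists f : X -> Y, isometry_onto A B f.

Definition embeds {R : realType} (Y X : metricType R) : Prop :=
  exists B : set X, isometric [set: Y] B.

Definition ultrahomogeneous {R : realType} (X : metricType R) : Prop :=
  forall (A B : set X) (f : X -> X),
    finite_set A -> finite_set B -> isometry_onto A B f ->
    exists g : X -> X,
      isometry_onto [set: X] [set: X] g /\ forall x : X, A x -> g x = f x.

Definition separable {R : realType} (X : metricType R) : Prop :=
  exists D : set X, countable D /\ dense D.

(* This is the axiom of completeType, which cannot be used directly because
   it requires a distinguished point. *)
Definition complete {R : realType} (X : metricType R) : Prop :=
  forall F : set_system X, ProperFilter F -> cauchy F ->
    exists x : X, F --> x.

(* Extended-real valued, hence +oo on unbounded spaces and -oo on the empty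
   space. *)
Definition diameter {R : realType} (X : metricType R) : \bar R :=
  ereal_sup [set (mdist p.1 p.2)%:E | p in [set: X * X]].

Definition urysohn_sphere {R : realType} (S : metricType R) : Prop :=
  [/\ complete S,
      separable S,
      ultrahomogeneous S,
      diameter S = 1%:E &
      forall Y : metricType R,
        separable Y -> (diameter Y <= 1%:E)%E -> embeds Y S].

Definition fattening {R : realType} {X : metricType R}
    (Y : set X) (eps : R) : set X :=
  [set x | exists y : X, Y y /\ mdist x y <= eps].

Definition indivisible {R : realType} (eps : R) (X : metricType R) : Prop :=
  forall k : nat, (1 <= k)%N -> forall chi : X -> 'I_k,
    exists (i : 'I_k) (X' : set X),
      isometric X' [set: X] /\ X' `<=` fattening (chi @^-1` [set i]) eps.

(* Main.v *)
(** Any coloring of [S] has a class [C] such that a copy of a dense sequence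
    [D] lies within [1/4] of [C]; its closure is a copy of [S] within [1/3].
    Suppose that this fails, and treat the colors in turn, with a finite list
    [L] of distance constraints, all in [[1/4, 3/4]], which no point of an
    earlier color satisfies.  Copy [D] greedily by points within [1/4] of the
    current color and at distance [1/2] from the points of [L].  At some stage
    no further point exists: a one-point type [p] over a finite set [F] is
    omitted.  Any point at distance [(p + 1/2) / 2] from [F] satisfying [L] is
    within [1/4] of some realization of [p] at distance [1/2] from [L], so it
    does not have the current color: extend [L] by these constraints.  After the
    last color, [L] has no solution at all, although it is consistent with the
    triangle inequality, against the extension property of [S]. *)

Require Import Defs.
From HB Require Import structures.
From mathcomp Require Import all_boot all_order all_algebra.
From mathcomp Require Import all_classical all_reals all_analysis.
From mathcomp Require Import lra.

Set Implicit Arguments.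
Unset Strict Implicit.
Unset Printing Implicit Defensive.

Import Order.TTheory GRing.Theory Num.Theory.

Local Open Scope classical_set_scope.
Local Open Scope ring_scope.

(** * Metric spaces built from explicit distance functions *)

Record metric_axioms {R : realType} {T : Type} (d : T -> T -> R) : Prop :=
  MetricAxioms {
    metric_axiom_refl : forall x, d x x = 0;
    metric_axiom_eq0 : forall x y, d x y = 0 -> x = y;
    metric_axiom_sym : forall x y, d x y = d y x;
    metric_axiom_triangle : forall y x z, d x z <= d x y + d y z }.

(** Carrying [hd] in the type lets the metric structure be inferred from the type alone. *)
Definition metrized {R : realType} {T : choiceType} (d : T -> T -> R)
  (hd : metric_axioms d) : Type := T.

Section Metrized.
Variables (R : realType) (T : choiceType) (d : T -> T -> R).
Variable hd : metric_axioms d.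

HB.instance Definition _ := Choice.on (metrized hd).
HB.instance Definition _ := isMetric.Build R (metrized hd)
  (metric_axiom_refl hd) (metric_axiom_eq0 hd) (metric_axiom_sym hd)
  (metric_axiom_triangle hd).

Lemma mdist_metrized (x y : metrized hd) : mdist x y = d x y.
Proof. by []. Qed.

End Metrized.

(** * Adding one point to a finite subspace *)

Section OnePointExtension.
Variables (R : realType) (S : metricType R) (F : seq S) (q : S -> R).

Definition one_point_dist (a b : option (seq_sub F)) : R :=
  match a, b with
  | Some x, Some y => mdist (ssval x) (ssval y)
  | Some x, None => q (ssval x)
  | None, Some y => q (ssval y)
  | None, None => 0
  end.

(** The two-sided bound is exactly the triangle inequality for triples containing the new point
    [None]; positivity of [q] keeps that point apart from [F]. *)
Lemma one_point_dist_axioms :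
  (forall x, x \in F -> 0 < q x) ->
  (forall x y, x \in F -> y \in F ->
     `|q x - q y| <= mdist x y <= q x + q y) ->
  metric_axioms one_point_dist.
Proof.
move=> q0 qL; split.
- by case=> [x|] //=; rewrite mdistxx.
- case=> [x|] [y|] //=.
  + by move=> /mdist_positivity /val_inj ->.
  + by move=> qx; have := q0 _ (ssvalP x); rewrite qx ltxx.
  + by move=> qx; have := q0 _ (ssvalP y); rewrite qx ltxx.
- by case=> [x|] [y|] //=; rewrite metric_sym.
- case=> [x|] [y|] [z|] //=.
  + exact: metric_triangle.
  + by have := qL _ _ (ssvalP y) (ssvalP x); rewrite ler_norml; lra.
  + have := qL _ _ (ssvalP z) (ssvalP x).
    by rewrite ler_norml metric_sym; lra.
  + by have := q0 _ (ssvalP x); lra.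
  + by have := qL _ _ (ssvalP y) (ssvalP z); rewrite ler_norml; lra.
  + by lra.
  + by lra.
Qed.

End OnePointExtension.
Arguments one_point_dist {R S} F q.

(** Serves to invert isometric embeddings by total functions; [v] is the value off the range of
    [h]. *)
Lemma factor_through_injective (T U V : Type) (h : T -> U) (k : T -> V) (v : V) :
  injective h -> exists f : U -> V, forall x, f (h x) = k x.
Proof.
move=> hI.
exists (fun u => if pselect (exists x, h x = u) is left e
                 then k (projT1 (cid e)) else v) => x.
case: pselect => [e|[]]; last by exists x.
by case: (cid e) => y /= /hI ->.
Qed.

Lemma mdist_preserving_inj (R : realType) (T U : metricType R) (h : T -> U) :
  (forall x y, mdist (h x) (h y) = mdist x y) -> injective h.
Proof.
by move=> hd x y hxy; apply: mdist_positivity; rewrite -hd hxy mdistxx.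
Qed.

(** * Finite systems of distance constraints *)

Section Types.
Variables (R : realType) (S : metricType R).
Implicit Types (L : seq (S * R)) (z : S).

(** A finite Katetov function given by its graph. The case [u = v] forces nonnegative values, and
    entries over the same point must agree. *)
Definition katetov L : Prop := forall u v, u \in L -> v \in L ->
  `|u.2 - v.2| <= mdist u.1 v.1 <= u.2 + v.2.

Definition realizes z L : Prop := forall u, u \in L -> mdist z u.1 = u.2.

End Types.

(** * Extension properties of the Urysohn sphere *)

Section UrysohnSphere.
Variables (R : realType) (S : metricType R) (hS : urysohn_sphere S).
Implicit Types (L : seq (S * R)) (x z : S) (D y : nat -> S).

Lemma sphere_mdist_le1 (x y : S) : mdist x y <= 1.
Proof.
have [_ _ _ diam1 _] := hS.
rewrite -lee_fin -diam1; apply: ereal_sup_ubound.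
by exists (x, y).
Qed.

Lemma sphere_inhabited : inhabited S.
Proof.
have [_ _ _ diam1 _] := hS.
apply: contrapT => S0.
suff: diameter S = -oo%E by rewrite diam1.
rewrite /diameter (_ : [set _ | _ in _] = set0) ?ereal_sup0//.
by rewrite -subset0 => r [[x y] _ _]; apply: S0; exists.
Qed.

Lemma sphere_dense_sequence :
  exists D : nat -> S, forall x e, 0 < e -> exists n, mdist x (D n) < e.
Proof.
have [_ [D [cD dD]] _ _ _] := hS.
have ball_D x e : 0 < e -> exists2 y, D y & mdist x y < e.
  move=> e0; have [||y [xy Dy]] := dD (interior (ball x e)).
  - by exists x; apply: nbhsx_ballx.
  - exact: open_interior.
  - exists y => //; have := interior_subset xy.
    by rewrite ballEmdist.
have [x0] := sphere_inhabited.
case/pfcard_geP: cD => [D0|/surjfunPex[f fD]].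
  by have [y] := ball_D x0 1 ltr01; rewrite D0.
exists f => x e /(ball_D x)[y]; rewrite fD => -[n _ <-] xy.
by exists n.
Qed.

(** A base point with value 0 is itself a solution. Otherwise the one-point extension of the base
    points is a finite metric space of diameter at most 1: embed it in [S], then move the copy of
    the base points back by ultrahomogeneity. *)
Lemma sphere_extension L : katetov L -> (forall u, u \in L -> u.2 <= 1) ->
  exists z, realizes z L.
Proof.
move=> kL L1; have [_ _ uhS diam1 univ] := hS.
have L0 u : u \in L -> 0 <= u.2.
  by move=> uL; have := kL u u uL uL; rewrite mdistxx; lra.
have [/hasP[u uL /eqP u0]|/hasPn Lneq0] := boolP (has (fun u => u.2 == 0) L).
  exists u.1 => v vL; have := kL u v uL vL.
  by rewrite u0 ler_norml; lra.
pose F := [seq u.1 | u <- L].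
(* The first entry over [x] is chosen; any other one has the same value by [kL]. *)
pose q x := nth 0 [seq u.2 | u <- L] (index x F).
have qL x : x \in F -> (x, q x) \in L.
  rewrite /q /F; elim: L {kL L1 L0 Lneq0 F q} => [//|[y r] L IH] /=.
  rewrite in_cons eq_sym; case: eqVneq => [->|yx] /=.
    by rewrite mem_head.
  by rewrite in_cons => /IH ->; rewrite orbT.
have hd : metric_axioms (one_point_dist F q).
  apply: one_point_dist_axioms => [x /qL xL|x y /qL xL /qL yL].
    by have := L0 _ xL; have := Lneq0 _ xL => /=; rewrite lt_neqAle eq_sym => -> ->.
  exact: kL xL yL.
have [||B [phi [[_ phiI _] phid]]] := univ (metrized hd).
- exists setT; split; first exact: (@countableP (option (seq_sub F))).
  by move=> O [x Ox] _; exists x.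
- apply: ge_ereal_sup => _ [[a b] _ <-]; rewrite lee_fin mdist_metrized /=.
  case: a b => [a|] [b|] //=.
  + exact: sphere_mdist_le1.
  + exact: L1 (qL _ (ssvalP a)).
  + exact: L1 (qL _ (ssvalP b)).
have [x0] := sphere_inhabited.
have phid' (a b : metrized hd) : mdist (phi a) (phi b) = one_point_dist F q a b.
  exact: phid.
have phiSI : injective (fun x : seq_sub F => phi (Some x)).
  move=> a b /(mdist_preserving_inj (h := phi) (fun a b => phid a b I I)).
  by move=> [].
have [f fphi] := factor_through_injective (fun x : seq_sub F => ssval x) x0 phiSI.
have [|||g [[_ gd] gf]] := uhS [set phi (Some x) | x in [set: seq_sub F]]
    [set` F] f.
- exact/finite_image/finite_finset.
- exact: finite_seq.
- split; first split.
  + by move=> _ [x _ <-]; rewrite fphi; apply: ssvalP.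
  + move=> _ _ /set_mem[a _ <-] /set_mem[b _ <-].
    by rewrite !fphi => /val_inj ->.
  + by move=> x /= xF; exists (phi (Some (SeqSub xF))); rewrite ?fphi//; exists (SeqSub xF).
  + by move=> _ _ [a _ <-] [b _ <-]; rewrite !fphi phid'.
exists (g (phi None)) => u uL.
have uF : u.1 \in F by apply: map_f.
have -> : u.1 = g (phi (Some (SeqSub uF))) by rewrite gf ?fphi//; exists (SeqSub uF).
rewrite gd// phid' /=; apply/eqP; rewrite -subr_eq0 -normr_le0.
by have /andP[] := kL _ _ (qL _ uF) uL; rewrite mdistxx.
Qed.

(** By completeness, [h x] is the limit of [y n] as [D n] tends to [x]; distances pass to the
    limit. *)
Lemma extend_isometry_from_dense (D y : nat -> S) :
  (forall x e, 0 < e -> exists n, mdist x (D n) < e) ->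
  (forall m n, mdist (y m) (y n) = mdist (D m) (D n)) ->
  exists h : S -> S, (forall x x', mdist (h x) (h x') = mdist x x') /\
    forall x n, mdist (h x) (y n) = mdist x (D n).
Proof.
move=> dD yD; have [cS _ _ _ _] := hS.
have eq_dist (a b : R) : (forall e, 0 < e -> `|a - b| <= e) -> a = b.
  by move=> ab; apply/eqP; rewrite -subr_eq0 -normr_le0; apply/ler_addgt0Pr
    => e e0; rewrite add0r ab.
have lim x : exists z, forall n, mdist z (y n) = mdist x (D n).
  (* The sets [N e] generate a Cauchy filter, which avoids choosing a subsequence of [D]. *)
  pose N e := [set y n | n in [set n | mdist x (D n) < e]].
  pose G := filter_from [set e : R | 0 < e] N.
  have GF : ProperFilter G.
    apply: filter_from_proper; last first.
      by move=> e /(dD x)[n xn]; exists (y n), n.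
    apply: filter_from_filter; first by exists 1 => /=.
    move=> e1 e2 /= e1_gt0 e2_gt0; exists (Num.min e1 e2) => /=.
      by rewrite lt_min e1_gt0.
    by move=> _ [n /= + <-]; rewrite lt_min => /andP[? ?]; split; exists n.
  have [|z Gz] := cS G GF.
    apply: cauchy_exP => e e0.
    have e20 : 0 < e / 2 by lra.
    have [m xm] := dD x _ e20.
    exists (y m), (e / 2) => // _ [n /= xn <-].
    rewrite ballEmdist /= yD.
    have := metric_triangle (D m) x (D n).
    by rewrite (metric_sym (D m) x); lra.
  exists z => m; apply: eq_dist => e e0.
  have e20 : 0 < e / 2 by lra.
  have [r r0 Nr] := Gz _ (nbhsx_ballx z _ e20).
  have mr0 : 0 < Num.min r (e / 2) by rewrite lt_min r0.
  have [n] := dD x _ mr0; rewrite lt_min => /andP[xr xe].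
  have /Nr : N r (y n) by exists n.
  rewrite ballEmdist /= => zn.
  have := metric_triangle z (y n) (y m).
  have := metric_triangle (y n) z (y m).
  have := metric_triangle x (D n) (D m).
  have := metric_triangle (D n) x (D m).
  rewrite (metric_sym (y n) z) (metric_sym (D n) x) yD ler_norml.
  by lra.
have [h hy] := choice lim.
exists h; split=> // x x'; apply: eq_dist => e e0.
have e20 : 0 < e / 2 by lra.
have [n xn] := dD x _ e20.
have := metric_triangle (h x) (y n) (h x').
have := metric_triangle (y n) (h x) (h x').
have := metric_triangle x (D n) x'.
have := metric_triangle (D n) x x'.
rewrite (metric_sym (y n) (h x)) (metric_sym (D n) x).
rewrite (metric_sym (y n)) (metric_sym (D n)) !hy ler_norml (metric_sym x' (D n)).
by lra.
Qed.

(** * Greedy copies and the elimination of one color *)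

Definition partial_copy (D y : nat -> S) (G : set S) (n : nat) : Prop :=
  (forall i, (i < n)%N -> G (y i)) /\
  forall i j, (i < n)%N -> (j < n)%N -> mdist (y i) (y j) = mdist (D i) (D j).

Lemma greedy_copy (D : nat -> S) (G : set S) :
  (forall n y, partial_copy D y G n ->
     exists2 z, G z & forall i, (i < n)%N -> mdist z (y i) = mdist (D n) (D i)) ->
  exists y, forall n, partial_copy D y G n.
Proof.
move=> ext; have [x0] := sphere_inhabited.
(* The next point is chosen for every list, with junk value [x0] where no extension exists, so that
   the choice can be iterated. *)
have /choice[next nextP] : forall s : seq S, exists z : S,
    partial_copy D (nth x0 s) G (size s) -> G z /\
    forall i, (i < size s)%N ->
      mdist z (nth x0 s i) = mdist (D (size s)) (D i).
  move=> s; have [/ext[z Gz zs]|ns] :=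
    pselect (partial_copy D (nth x0 s) G (size s)).
    by exists z.
  by exists x0.
pose prefix n := iter n (fun s => rcons s (next s)) [::].
pose y n := next (prefix n).
have prefixE n : prefix n = mkseq y n.
  by elim: n => [//|n IH]; rewrite mkseqS -IH.
exists y; elim=> [|n [Gy dy]]; first by split.
have [] := nextP (prefix n).
  rewrite prefixE size_mkseq; split=> [i|i j] ilt.
    by rewrite nth_mkseq//; apply: Gy.
  by move=> jlt; rewrite !nth_mkseq// dy.
rewrite -/(y n) prefixE size_mkseq => Gyn dyn.
have dyn' i : (i < n)%N -> mdist (y n) (y i) = mdist (D n) (D i).
  by move=> ilt; rewrite -dyn// nth_mkseq.
split=> [i|i j]; rewrite !ltnS.
  by rewrite leq_eqVlt => /predU1P[->|/Gy].
rewrite leq_eqVlt => /predU1P[->|ilt];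
  rewrite leq_eqVlt => /predU1P[->|jlt].
- by rewrite !mdistxx.
- exact: dyn'.
- by rewrite metric_sym dyn'// metric_sym.
- exact: dy.
Qed.

Lemma avoid_next_color (D : nat -> S) (C : set S) L :
  katetov L -> (forall u, u \in L -> 1/4 <= u.2 <= 3/4) ->
  (~ exists y, forall n, partial_copy D y (fattening C (1/4)) n) ->
  exists L', [/\ katetov L', (forall u, u \in L' -> 1/4 <= u.2 <= 3/4),
    (forall z, realizes z L' -> realizes z L) &
    forall z, realizes z L' -> ~ C z].
Proof.
move=> kL L14 nocopy.
pose G := [set z | fattening C (1/4) z /\ realizes z [seq (u.1, 1/2) | u <- L]].
have [n [y [yG omitted]]] : exists n y, partial_copy D y G n /\
    ~ exists2 z, G z & forall i, (i < n)%N -> mdist z (y i) = mdist (D n) (D i).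
  apply: contrapT => noomit; apply: nocopy.
  have [|y yG] := @greedy_copy D G.
    move=> n y yG; apply: contrapT => noz; apply: noomit.
    by exists n, y.
  exists y => n; have [Gy dy] := yG n.
  by split=> // i /Gy[].
have [Gy dy] := yG.
(* Averaging the omitted type with 1/2 gives values in [1/4, 3/4], within 1/4 of both. Since the
   [y i] are at distance 1/2 from the points of [L], such values are compatible with those of
   [L]. *)
pose p i := (mdist (D n) (D i) + 1/2) / 2.
pose N := mkseq (fun i => (y i, p i)) n.
have yL u i : u \in L -> (i < n)%N -> mdist (y i) u.1 = 1/2.
  move=> uL ilt; have [_ /(_ (u.1, 1/2))] := Gy i ilt.
  by apply; apply/mapP; exists u.
have dD i := sphere_mdist_le1 (D n) (D i).
have dD0 i := mdist_ge0 (D n) (D i).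
have kN : katetov N.
  move=> _ _ /mapP[i + ->] /mapP[j + ->]; rewrite !mem_iota /= add0n => ilt jlt.
  rewrite dy// /p ler_norml.
  have := metric_triangle (D n) (D i) (D j).
  have := metric_triangle (D n) (D j) (D i).
  have := metric_triangle (D i) (D n) (D j).
  have := sphere_mdist_le1 (D i) (D j).
  have := mdist_ge0 (D i) (D j).
  by rewrite (metric_sym (D j) (D i)) (metric_sym (D i) (D n)); lra.
exists (L ++ N); split.
- move=> u v; rewrite !mem_cat => /orP[uL|uN] /orP[vL|vN].
  + exact: kL.
  + have := L14 _ uL; move: vN => /mapP[j + ->]; rewrite mem_iota /= add0n => jlt.
    rewrite metric_sym yL// /p ler_norml; have := dD j; have := dD0 j; lra.
  + have := L14 _ vL; move: uN => /mapP[j + ->]; rewrite mem_iota /= add0n => jlt.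
    rewrite yL// /p ler_norml; have := dD j; have := dD0 j; lra.
  + exact: kN.
- move=> u; rewrite mem_cat => /orP[/L14//|/mapP[j _ ->]].
  by rewrite /= /p; have := dD j; have := dD0 j; lra.
- by move=> z zL u uL; apply: zL; rewrite mem_cat uL.
move=> z zL Cz; apply: omitted.
have zL1 u : u \in L -> mdist z u.1 = u.2.
  by move=> uL; apply: zL; rewrite mem_cat uL.
have zy i : (i < n)%N -> mdist z (y i) = p i.
  move=> ilt; apply: (zL (y i, p i)); rewrite mem_cat; apply/orP; right.
  by apply/mapP; exists i => //; rewrite mem_iota.
(* If [z] had the color, [w] would lie in [G] and realize the omitted type. Between [z] and a point
   of [L] the triangle inequality reads 1/4 <= [u.2] <= 3/4, which is [L14]. *)
have [||w wM] := @sphere_extension ((z, 1/4) :: [seq (u.1, 1/2) | u <- L] ++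
    mkseq (fun i => (y i, mdist (D n) (D i))) n).
- have zM v : v \in [seq (u.1, 1/2) | u <- L] ++
      mkseq (fun i => (y i, mdist (D n) (D i))) n ->
      `|1/4 - v.2| <= mdist z v.1 <= 1/4 + v.2.
    rewrite mem_cat => /orP[/mapP[u uL ->]|/mapP[i + ->]] /=.
      by rewrite zL1// ler_norml; have := L14 _ uL; lra.
    rewrite mem_iota /= add0n => /zy ->; rewrite /p ler_norml.
    by have := dD i; have := dD0 i; lra.
  move=> u v; rewrite !(in_cons (z, 1/4)) => /predU1P[->|uM] /predU1P[->|vM].
  + by rewrite mdistxx /= subrr normr0; lra.
  + exact: zM.
  + by rewrite metric_sym distrC (addrC u.2); apply: zM.
  move: uM vM; rewrite !mem_cat.
  move=> /orP[/mapP[u' uL ->]|/mapP[i + ->]] /orP[/mapP[v' vL ->]|/mapP[j + ->]];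
    rewrite ?mem_iota ?add0n /=.
  + have := sphere_mdist_le1 u'.1 v'.1; have := mdist_ge0 u'.1 v'.1.
    by rewrite subrr normr0; lra.
  + move=> jlt; rewrite (metric_sym u'.1) yL// ler_norml.
    by have := dD j; have := dD0 j; lra.
  + move=> ilt; rewrite yL// ler_norml.
    by have := dD i; have := dD0 i; lra.
  + move=> ilt jlt; rewrite dy// ler_norml.
    have := metric_triangle (D n) (D i) (D j).
    have := metric_triangle (D n) (D j) (D i).
    have := metric_triangle (D i) (D n) (D j).
    by rewrite (metric_sym (D j) (D i)) (metric_sym (D i) (D n)); lra.
- move=> u; rewrite in_cons mem_cat.
  by move=> /or3P[/eqP ->|/mapP[v vL ->]|/mapP[i _ ->]] //=; lra.
exists w.
  split; last by move=> u uL; apply: wM; rewrite in_cons mem_cat uL orbT.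
  exists z; split=> //; rewrite (wM (z, 1/4)) ?mem_head//.
move=> i ilt; apply: (wM (y i, mdist (D n) (D i))).
rewrite in_cons mem_cat; apply/or3P; apply: Or33.
by apply/mapP; exists i => //; rewrite mem_iota.
Qed.

End UrysohnSphere.

(** * Exhausting the colors, and closing up the copy of the dense sequence *)

Theorem theorem2 (R : realType) (S : metricType R) (hS : urysohn_sphere S) :
  indivisible (1 / 3 : R) S.
Proof.
move=> k _ chi.
have [D dD] := sphere_dense_sequence hS.
have [i [y yC]] : exists i y, forall n,
    partial_copy D y (fattening (chi @^-1` [set i]) (1/4)) n.
  apply: contrapT => nocopy.
  (* At [j = k] the system has no solution, contradicting [sphere_extension]. *)
  suff avoid j : (j <= k)%N -> exists L : seq (S * R),
      [/\ katetov L, (forall u, u \in L -> 1/4 <= u.2 <= 3/4) &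
          forall z, realizes z L -> (j <= chi z)%N].
    have [L [kL L14 kchi]] := avoid k (leqnn k).
    have [u /L14|z /kchi] := sphere_extension hS kL; first by lra.
    by rewrite leqNgt ltn_ord.
  elim: j => [_|j IH jk]; first by exists [::].
  have [L [kL L14 jchi]] := IH (ltnW jk).
  have [|L' [kL' L'14 L'L L'j]] := @avoid_next_color _ _ hS D
      (chi @^-1` [set Ordinal jk]) L kL L14.
    by case=> y yC; apply: nocopy; exists (Ordinal jk), y.
  exists L'; split=> // z zL'; rewrite ltn_neqAle jchi ?andbT; last exact: L'L.
  by apply/eqP => jz; apply: (L'j z zL'); apply: val_inj.
have [h [hd hy]] : exists h : S -> S,
    (forall x x', mdist (h x) (h x') = mdist x x') /\
    forall x n, mdist (h x) (y n) = mdist x (D n).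
  apply: (extend_isometry_from_dense hS) => // m n.
  have [_ ->//] := yC (maxn m n).+1; rewrite ltnS ?leq_maxl ?leq_maxr//.
have hI := mdist_preserving_inj hd.
have [x0] := sphere_inhabited hS.
(* [isometric] asks for a map from the copy onto [S], hence the inverse of [h]. *)
have [f fh] := factor_through_injective id x0 hI.
exists i, (range h); split.
  exists f; split; first split.
  - by [].
  - by move=> _ _ /set_mem[a _ <-] /set_mem[b _ <-]; rewrite !fh => ->.
  - by move=> x _; exists (h x); rewrite ?fh//; exists x.
  - by move=> _ _ [a _ <-] [b _ <-]; rewrite !fh hd.
move=> _ [x _ <-].
(* The slack is 1/12 = 1/3 - 1/4. *)
have e0 : (0 : R) < 1/12 by lra.
have [n xn] := dD x _ e0.
have [yC' _] := yC n.+1.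
have [c [Cc cy]] := yC' n (ltnSn n).
exists c; split=> //.
have := metric_triangle (h x) (y n) c; rewrite hy; lra.
Qed.
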